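(* Let $M$ be a connected $C^\infty$ manifold without boundary endowed with a complete Riemannian metric, and let $V:M\to\mathbb{R}$ be a bounded $C^2$ function. Then the Hamilton-Jacobi equation $$\frac12\|d_xu\|^2+V(x)=\sup_{x\in M}V(x)$$ has a global viscosity solution $u:M\to\mathbb{R}$.
   Context: $\|\cdot\|$ on $T^*_xM$ is the norm dual to the Riemannian norm on $T_xM$. Viscosity solutions: for $F:T^*M\to\mathbb{R}$ continuous and $c\in\mathbb{R}$, a continuous function $u:M\to\mathbb{R}$ is a viscosity subsolution (resp. supersolution) of $F(x,d_xu)=c$ if for each $C^1$ function $\phi:M\to\mathbb{R}$ such that $u-\phi$ admits a maximum (resp. minimum) at some $x_0\in M$, one has $F(x_0,d_{x_0}\phi)\le c$ (resp. $F(x_0,d_{x_0}\phi)\ge c$). It is a (global) viscosity solution if it is both. Here $F(x,p)=\frac12\|p\|^2+V(x)$ and $c=\sup_M V$. *)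

(* Defs.v *)
From HB Require Import structures.
From mathcomp Require Import all_boot all_order all_algebra.
From mathcomp Require Import all_classical all_reals all_analysis.

Set Implicit Arguments.
Unset Strict Implicit.
Unset Printing Implicit Defensive.

Import Order.TTheory GRing.Theory Num.Theory.
Import numFieldNormedType.Exports.

Local Open Scope classical_set_scope.
Local Open Scope ring_scope.

(* Only meaningful for U open, where it is the usual class C^k(U). *)
Fixpoint Ck_on (R : realType) (n k : nat) (U : set 'rV[R]_n)
    (f : 'rV[R]_n -> R) : Prop :=
  match k with
  | 0 => forall y, U y -> {for y, continuous f}
  | k'.+1 => (forall y, U y -> differentiable f y) /\
             (forall i : 'I_n, Ck_on k' U (fun y => 'D_(delta_mx 0 i) f y))
  end.

(* A homeomorphism cmap from an open subset cdom of M onto an open subset cimg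
   of R^n, with inverse cinv; the values of cmap outside cdom and of cinv
   outside cimg are irrelevant. *)
Record chart (R : realType) (n : nat) (M : topologicalType) := Chart {
  cdom : set M;
  cimg : set 'rV[R]_n;
  cmap : M -> 'rV[R]_n;
  cinv : 'rV[R]_n -> M;
  open_cdom : open cdom;
  open_cimg : open cimg;
  cmap_img : forall x, cdom x -> cimg (cmap x);
  cinv_dom : forall y, cimg y -> cdom (cinv y);
  cmapK : forall x, cdom x -> cinv (cmap x) = x;
  cinvK : forall y, cimg y -> cmap (cinv y) = y;
  cmap_continuous : forall x, cdom x -> {for x, continuous cmap};
  cinv_continuous : forall y, cimg y -> {for y, continuous cinv} }.

Definition smooth_transition (R : realType) (n : nat) (M : topologicalType)
    (c c' : chart R n M) : Prop :=
  forall (k : nat) (j : 'I_n),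
    Ck_on k (cimg c `&` cinv c @^-1` cdom c')
      (fun y => cmap c' (cinv c y) 0 j).

(* The atlas need not be maximal.  chart_at selects a chart around each point;
   it carries no regularity and only serves to give the tangent spaces a
   concrete carrier (see tangent). *)
Record smoothManifold (R : realType) (n : nat) := SmoothManifold {
  carrier :> topologicalType;
  hausdorff_carrier : hausdorff_space carrier;
  second_countable_carrier : @second_countable carrier;
  atlas : set (chart R n carrier);
  chart_at : carrier -> chart R n carrier;
  atlas_smooth : forall c c', atlas c -> atlas c' -> smooth_transition c c';
  chart_at_atlas : forall x, atlas (chart_at x);
  chart_at_dom : forall x, cdom (chart_at x) x }.

Definition Ck_fun (R : realType) (n : nat) (M : smoothManifold R n) (k : nat)
    (f : M -> R) : Prop :=
  forall c, atlas c -> Ck_on k (cimg c) (f \o cinv c).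

(* T_x M, identified with R^n through the chart chart_at M x: the row v stands
   for the tangent vector whose components in that chart are v. *)
Definition tangent (R : realType) (n : nat) (M : smoothManifold R n) (x : M) :=
  'rV[R]_n.

Definition cotangent (R : realType) (n : nat) (M : smoothManifold R n)
    (x : M) := {linear 'rV[R]_n -> R^o}.

(* d_x f, for f differentiable at x. *)
Definition differential (R : realType) (n : nat) (M : smoothManifold R n)
    (f : M -> R) (x : M) : cotangent x :=
  'd ((f \o cinv (chart_at x)) : 'rV[R]_n -> R^o) (cmap (chart_at x) x).

(* The i-th coordinate vector of the chart c at the point of coordinates y,
   re-expressed in the chart selected at that point. *)
Definition coord_vector (R : realType) (n : nat) (M : smoothManifold R n)
    (c : chart R n M) (y : 'rV[R]_n) (i : 'I_n) : tangent (cinv c y) :=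
  'd (cmap (chart_at (cinv c y)) \o cinv c) y (delta_mx 0 i).

Record riemannianMetric (R : realType) (n : nat) (M : smoothManifold R n) :=
  RiemannianMetric {
  inner : forall x : M, tangent x -> tangent x -> R;
  inner_sym : forall (x : M) (v w : tangent x), inner v w = inner w v;
  inner_linear : forall (x : M) (a : R) (v v' w : 'rV[R]_n),
    @inner x (a *: v + v') w = a * @inner x v w + @inner x v' w;
  inner_gt0 : forall (x : M) (v : 'rV[R]_n), v != 0 -> 0 < @inner x v v;
  inner_smooth : forall c, atlas c -> forall (i j : 'I_n) (k : nat),
    Ck_on k (cimg c)
      (fun y => inner (coord_vector c y i) (coord_vector c y j)) }.

Definition tnorm (R : realType) (n : nat) (M : smoothManifold R n)
    (g : riemannianMetric M) (x : M) (v : tangent x) : R :=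
  Num.sqrt (inner g v v).

Definition dual_norm (R : realType) (n : nat) (M : smoothManifold R n)
    (g : riemannianMetric M) (x : M) (p : cotangent x) : R :=
  sup [set `|p v| | v in [set v : tangent x | tnorm g v <= 1]].

(* Curves are parametrized by the whole line; every C^1 curve on [0, 1] is the
   restriction of such a curve. *)
Definition C1_curve (R : realType) (n : nat) (M : smoothManifold R n)
    (gamma : R -> M) : Prop :=
  continuous gamma /\
  forall c, atlas c -> forall t, cdom c (gamma t) ->
    derivable (cmap c \o gamma) t 1 /\
    {for t, continuous (derive1 (cmap c \o gamma))}.

Definition velocity (R : realType) (n : nat) (M : smoothManifold R n)
    (gamma : R -> M) (t : R) : tangent (gamma t) :=
  derive1 (cmap (chart_at (gamma t)) \o gamma) t.

(* Length over [0, 1]. *)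
Definition curve_length (R : realType) (n : nat) (M : smoothManifold R n)
    (g : riemannianMetric M) (gamma : R -> M) : R :=
  \int[lebesgue_measure]_(t in `[0, 1]) tnorm g (velocity gamma t).

(* Some piecewise C^1 curve from x to y, i.e. a concatenation of finitely many
   C^1 curves, has length l. *)
Inductive joined_by_length (R : realType) (n : nat) (M : smoothManifold R n)
    (g : riemannianMetric M) : M -> M -> R -> Prop :=
| joined_nil x : joined_by_length g x x 0
| joined_cons gamma y l : C1_curve gamma ->
    joined_by_length g (gamma 1) y l ->
    joined_by_length g (gamma 0) y (curve_length g gamma + l).

Definition riemannian_dist (R : realType) (n : nat) (M : smoothManifold R n)
    (g : riemannianMetric M) (x y : M) : R :=
  inf [set l | joined_by_length g x y l].

Definition complete_metric (R : realType) (n : nat) (M : smoothManifold R n)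
    (g : riemannianMetric M) : Prop :=
  forall z : nat -> M,
    (forall e : R, 0 < e -> exists N, forall i j, (N <= i)%N -> (N <= j)%N ->
       riemannian_dist g (z i) (z j) < e) ->
    exists x : M, forall e : R, 0 < e -> exists N, forall i, (N <= i)%N ->
      riemannian_dist g (z i) x < e.

Section Viscosity.
Variables (R : realType) (n : nat) (M : smoothManifold R n).
Implicit Types (F : forall x : M, cotangent x -> R) (c : R) (u : M -> R).

Definition viscosity_subsolution F c u : Prop :=
  continuous u /\
  forall phi : M -> R, Ck_fun 1 phi -> forall x0 : M,
    (forall x, u x - phi x <= u x0 - phi x0) ->
    F x0 (differential phi x0) <= c.

Definition viscosity_supersolution F c u : Prop :=
  continuous u /\
  forall phi : M -> R, Ck_fun 1 phi -> forall x0 : M,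
    (forall x, u x0 - phi x0 <= u x - phi x) ->
    c <= F x0 (differential phi x0).

Definition viscosity_solution F c u : Prop :=
  viscosity_subsolution F c u /\ viscosity_supersolution F c u.

End Viscosity.

Definition hamiltonian (R : realType) (n : nat) (M : smoothManifold R n)
    (g : riemannianMetric M) (V : M -> R) (x : M) (p : cotangent x) : R :=
  2^-1 * dual_norm g p ^+ 2 + V x.

(* Main.v *)
Require Import Defs.
From HB Require Import structures.
From mathcomp Require Import all_boot all_order all_algebra.
From mathcomp Require Import all_classical all_reals all_analysis.
From mathcomp Require Import ring lra.

Set Implicit Arguments.
Unset Strict Implicit.
Unset Printing Implicit Defensive.

Import Order.TTheory GRing.Theory Num.Theory.
Import numFieldNormedType.Exports.

Local Open Scope classical_set_scope.
Local Open Scope ring_scope.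

(* Put f = sqrt (2 (sup V - V)); the equation reads |du| = f.  Let S be the set
   of functions whose slope at every point is at most f.  By a mean value
   argument along chart segments, S is locally equi-Lipschitz and closed under
   pointwise limits and suprema, so d(y, x) := sup {w x | w in S, w y = 0}
   defines an element d(y, .) of S, finite since M is connected.  An element of
   S is a viscosity subsolution.  If u in S fails to be a supersolution at x, a
   cone below a test function can be glued onto u near x to give w in S with
   w x > u x; maximality of d(y, .) forbids this as soon as y is far from x.  If
   V attains its supremum at x0, then d(x0, .) is a solution, the supersolution
   property being trivial at x0 since f x0 = 0.  Otherwise M is not compact, and
   a limit of d(y, .) - d(y, x1), with y leaving every compact set, is one. *)

(** * First-order approximation and a mean value inequality *)

(** Testing the bound at [x + t *: v] with [t] small, homogeneity cancels [t] and leaves [h v <= e].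
    This upgrades first-order comparisons near a point to exact inequalities between homogeneous
    functions. *)
Lemma pos_homogeneous_le0 (R : realType) (V : normedModType R) (h : V -> R)
    (x : V) :
  (forall (t : R) v, 0 < t -> h (t *: v) = t * h v) ->
  (forall e, 0 < e -> \forall y \near x, h (y - x) <= e * `|y - x|) ->
  forall v, h v <= 0.
Proof.
move=> hZ hle v; apply/ler_addgt0Pl => e e0; rewrite addr0.
have v1 : 0 < 1 + `|v| by rewrite ltr_pwDl.
have e1 : 0 < e / (1 + `|v|) by rewrite divr_gt0.
have /nbhs_normP[d /= d0 hd] := hle _ e1.
have t0 : 0 < d / (1 + `|v|) by rewrite divr_gt0.
have := hd (x + (d / (1 + `|v|)) *: v).
rewrite /= opprD addNKr normrN normrZ (gtr0_norm t0).
have -> : d / (1 + `|v|) * `|v| < d.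
  by rewrite mulrAC ltr_pdivrMr// ltr_pM2l// ltrDr.
rewrite addrAC subrr add0r hZ// normrZ (gtr0_norm t0) (mulrCA (e / _)).
rewrite ler_pM2l// => /(_ isT) /le_trans; apply.
by rewrite mulrAC ler_pdivrMr// ler_pM2l// lerDr.
Qed.

Lemma diff_approx (R : realType) (V W : normedModType R) (f : V -> W) (x : V) :
  differentiable f x -> forall e, 0 < e ->
  \forall y \near x, `|f y - f x - 'd f x (y - x)| <= e * `|y - x|.
Proof.
move=> /diff_locally/eqaddoP df e e0.
rewrite (near_shift 0 x); near=> y.
rewrite /= subr0 addrK -addrA -opprD.
near: y; exact: df.
Unshelve. all: by end_near. Qed.

(** The difference of two linear first-order approximations is homogeneous and [o(|y - x|)], hence
    zero. *)
Lemma diff_unique_approx (R : realType) (V W : normedModType R) (f : V -> W)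
    (L : {linear V -> W}) (x : V) :
  differentiable f x ->
  (forall e, 0 < e ->
    \forall y \near x, `|f y - f x - L (y - x)| <= e * `|y - x|) ->
  'd f x =1 L.
Proof.
move=> df fL v; apply/eqP; rewrite -subr_eq0 -normr_le0.
apply: (@pos_homogeneous_le0 _ _ (fun v => `|'d f x v - L v|) x).
  move=> t w t0; rewrite (linearZ_LR ('d f x)) (linearZ_LR L) -scalerBr.
  by rewrite normrZ gtr0_norm.
move=> e e0; have e2 : 0 < e / 2 by rewrite divr_gt0.
near=> y.
have h1 : `|f y - f x - 'd f x (y - x)| <= e / 2 * `|y - x|.
  by near: y; exact: diff_approx.
have h2 : `|f y - f x - L (y - x)| <= e / 2 * `|y - x|.
  by near: y; exact: fL.
rewrite [e]splitr mulrDl.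
apply: le_trans (ler_distD (f y - f x) _ _) _.
by rewrite lerD// distrC.
Unshelve. all: by end_near. Qed.

(** Continuous induction on the set of times [t] with [h t - h 0 <= L * t]: its supremum [s] belongs
    to it, and the bound near [s] leads beyond [s] unless [s = 1]. *)
Lemma local_slope_bound (R : realType) (h : R -> R) (L : R) :
  (forall t : R, 0 <= t <= 1 ->
    \forall s \near t, `|h s - h t| <= L * `|s - t|) ->
  h 1 - h 0 <= L.
Proof.
move=> hL.
pose A := [set t : R | 0 <= t <= 1 /\ h t - h 0 <= L * t].
have A0 : A 0 by rewrite /A /= subrr mulr0 lexx ler01.
have supA : has_sup A.
  by split; [exists 0 | exists 1 => t [/andP[]]].
set s := sup A.
have s0 : 0 <= s by exact: ub_le_sup supA.2 _ A0.
have s1 : s <= 1 by apply: ge_sup; [exists 0 | move=> t [/andP[]]].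
have s01 : 0 <= s <= 1 by rewrite s0.
have /nbhs_normP[d /= d0 hd] := hL _ s01.
have [t At st] := sup_adherent d0 supA.
have ts : t <= s by exact: ub_le_sup supA.2 _ At.
have hs : h s - h 0 <= L * s.
  have := hd t; rewrite /= ger0_norm ?subr_ge0// => /(_ _).
  have tsd : s - t < d by rewrite ltrBlDr addrC -ltrBlDr.
  move=> /(_ tsd); rewrite -normrN opprB (distrC t).
  rewrite (ger0_norm (_ : 0 <= s - t)) ?subr_ge0//.
  move=> /(le_trans (ler_norm _)); have := At.2; lra.
move: s1; rewrite le_eqVlt => /predU1P[s1|s1].
  by move: hs; rewrite s1 mulr1.
(* A point past [s], still in the unit interval and in the neighbourhood where the bound at [s]
   holds. *)
pose r := s + Num.min (d / 2) (1 - s).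
have m0 : 0 < Num.min (d / 2) (1 - s) by rewrite lt_min divr_gt0//= subr_gt0.
have md : Num.min (d / 2) (1 - s) <= d / 2 by rewrite ge_min lexx.
have m1 : Num.min (d / 2) (1 - s) <= 1 - s by rewrite ge_min lexx orbT.
suff Ar : A r.
  have : r <= s by exact: ub_le_sup supA.2 _ Ar.
  rewrite /r; lra.
split; first by rewrite /r; lra.
have := hd r.
rewrite /= {1}/r opprD addrA subrr sub0r normrN gtr0_norm// => /(_ _).
have md' : Num.min (d / 2) (1 - s) < d by lra.
move=> /(_ md') /(le_trans (ler_norm _)).
rewrite {2}/r addrAC subrr add0r gtr0_norm// {3}/r mulrDr; lra.
Qed.

Lemma differentiable_rV (R : realType) (V : normedModType R) n
    (f : V -> 'rV[R]_n) (x : V) :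
  (forall j, differentiable (fun y => f y 0 j) x) -> differentiable f x.
Proof.
move=> df.
have -> : f = \sum_(j < n) (fun y => f y 0 j *: (delta_mx 0 j : 'rV[R]_n)).
  by apply/funext => y; rewrite fct_sumE -row_sum_delta.
by apply: differentiable_sum => j; exact: differentiableZl.
Qed.

Lemma near_dist_lt (R : realType) (V : normedModType R) (x : V) (d : R) :
  0 < d -> \forall y \near x, `|y - x| < d.
Proof.
move=> d0; apply/nbhs_normP; exists d => // y /=.
by rewrite distrC.
Qed.

(** * Riemannian norm and its expression in charts *)

Section RiemannianNorm.
Context {R : realType} {n : nat} {M : smoothManifold R n}.
Variable g : riemannianMetric M.

Section AtPoint.
Variable x : M.
Implicit Types (v w : tangent x) (a : R).

Lemma innerDl v v' w : inner g (v + v') w = inner g v w + inner g v' w.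
Proof. by have := @inner_linear _ _ _ g x 1 v v' w; rewrite scale1r mul1r. Qed.

Lemma inner0l w : inner g (0 : tangent x) w = 0.
Proof. by have := innerDl 0 0 w; rewrite addr0; lra. Qed.

Lemma innerZl a v w : inner g (a *: v) w = a * inner g v w.
Proof. by have := @inner_linear _ _ _ g x a v 0 w; rewrite inner0l !addr0. Qed.

Lemma inner_ge0 v : 0 <= inner g v v.
Proof.
have [->|v0] := eqVneq v 0; first by rewrite inner0l.
exact/ltW/inner_gt0.
Qed.

Lemma tnorm_ge0 v : 0 <= tnorm g v.
Proof. exact: sqrtr_ge0. Qed.

Lemma sqr_tnorm v : tnorm g v ^+ 2 = inner g v v.
Proof. by rewrite sqr_sqrtr// inner_ge0. Qed.

Lemma tnorm_gt0 v : v != 0 -> 0 < tnorm g v.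
Proof. by move=> v0; rewrite sqrtr_gt0 inner_gt0. Qed.

Lemma tnormZ a v : tnorm g (a *: v : tangent x) = `|a| * tnorm g v.
Proof.
rewrite /tnorm innerZl inner_sym innerZl mulrA -expr2 sqrtrM ?sqr_ge0//.
by rewrite sqrtr_sqr.
Qed.

Lemma tnorm0 : tnorm g (0 : tangent x) = 0.
Proof. by rewrite /tnorm inner0l sqrtr0. Qed.

(** Cauchy-Schwarz: with [A], [B], [C] the products of [v] with [v], [v] with [w] and [w] with [w],
    positivity at [C v - B w] reads [0 <= C (A C - B^2)]. *)
Lemma inner_le_tnorm v w : inner g v w <= tnorm g v * tnorm g w.
Proof.
have [->|w0] := eqVneq w 0.
  by rewrite inner_sym inner0l mulr_ge0 ?tnorm_ge0.
have C0 : 0 < inner g w w by exact: inner_gt0.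
have : 0 <= inner g (inner g w w *: v + (- inner g v w) *: w : tangent x)
                    (inner g w w *: v + (- inner g v w) *: w : tangent x).
  exact: inner_ge0.
rewrite innerDl !innerZl !(inner_sym g _ (_ + _)) !innerDl !innerZl.
rewrite (inner_sym g w v).
set A := inner g v v; set B := inner g v w; set C := inner g w w in C0 *.
move=> h; have {}h : 0 <= C * (A * C - B ^+ 2).
  by apply: le_trans h _; rewrite le_eqVlt; apply/orP; left; apply/eqP; ring.
rewrite pmulr_rge0// subr_ge0 in h.
apply: le_trans (ler_norm _) _.
by rewrite -sqrtr_sqr /tnorm -sqrtrM ?inner_ge0// ler_wsqrtr.
Qed.

Lemma ler_tnormD v w : tnorm g (v + w : tangent x) <= tnorm g v + tnorm g w.
Proof.
rewrite -(@ler_pXn2r _ 2)// ?nnegrE ?addr_ge0 ?tnorm_ge0//.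
rewrite sqr_tnorm sqrrD !sqr_tnorm innerDl !(inner_sym g _ (v + w)) !innerDl.
have := inner_le_tnorm v w; rewrite (inner_sym g w v); lra.
Qed.

End AtPoint.
End RiemannianNorm.

Lemma lipschitz_at_continuous (R : realType) (V : normedModType R) (f : V -> R)
    (x : V) (C : R) :
  (\forall y \near x, `|f y - f x| <= C * `|y - x|) -> {for x, continuous f}.
Proof.
move=> fC; apply/cvgrPdist_le => e e0.
have C1 : 0 < 1 + `|C| by rewrite ltr_pwDl.
have d0 : 0 < e / (1 + `|C|) by rewrite divr_gt0.
near=> y; rewrite distrC.
have yx : `|y - x| <= e / (1 + `|C|).
  rewrite distrC; near: y.
  by apply/nbhs_normP; exists (e / (1 + `|C|)) => //= y /ltW.
apply: (@le_trans _ _ (C * `|y - x|)); first by near: y.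
apply: (@le_trans _ _ ((1 + `|C|) * `|y - x|)).
  by rewrite ler_wpM2r// (le_trans (ler_norm _))// lerDr.
by rewrite mulrC -ler_pdivlMr.
Unshelve. all: by end_near. Qed.

Lemma norm_coord_le (R : realType) n (v : 'rV[R]_n) (i : 'I_n) :
  `|v 0 i| <= `|v|.
Proof.
rewrite [leRHS]/Num.norm /= mx_normrE.
exact: (le_bigmax _ (fun i : 'I_1 * 'I_n => `|v i.1 i.2|) (0, i)).
Qed.

(** Subadditivity of the square root. It turns closeness of squared norms into closeness of norms,
    without a lower bound on either. *)
Lemma ler_dist_sqrt (R : realType) (a b : R) : 0 <= a -> 0 <= b ->
  `|Num.sqrt a - Num.sqrt b| <= Num.sqrt `|a - b|.
Proof.
wlog ab : a b / b <= a.
  move=> h a0 b0; have [ba|/ltW ab] := leP b a; first exact: h.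
  by rewrite distrC (distrC a) h.
move=> a0 b0; rewrite !ger0_norm ?subr_ge0// ?ler_wsqrtr//.
rewrite lerBlDr -(@ler_pXn2r _ 2)// ?nnegrE ?addr_ge0 ?sqrtr_ge0//.
rewrite sqrrD !sqr_sqrtr ?subr_ge0// addrAC subrK lerDl.
by rewrite mulrn_wge0// mulr_ge0 ?sqrtr_ge0.
Qed.

(** Meant for closed balls, with [A] the [t <= r], and for spheres, with [A] reduced to [r]. *)
Lemma compact_norm_preimage (R : realType) n (q : 'rV[R]_n) (A : set R)
    (r : R) :
  closed A -> (forall t, A t -> t <= r) -> compact [set p | A `|p - q|].
Proof.
move=> cA Ar; apply: bounded_closed_compact.
  exists (r + `|q|); split; first exact: num_real.
  move=> y ry p /= /Ar pq; rewrite -(subrK q p).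
  apply: le_trans (ler_normD _ _) _.
  by rewrite (le_trans _ (ltW ry))// lerD2r.
apply: (@closed_comp _ _ (fun p : 'rV[R]_n => `|p - q|) A) => // p _.
apply: (@lipschitz_at_continuous _ _ _ _ 1); near=> p'.
rewrite mul1r; apply: le_trans (ler_dist_dist _ _) _.
by rewrite opprB addrA subrK.
Unshelve. all: by end_near. Qed.

Section NormComparison.
Context {R : realType} {n : nat} {M : smoothManifold R n}.
Variables (g : riemannianMetric M) (x : M).

Lemma tnorm_le_norm :
  exists2 C, 0 < C & forall v : tangent x, tnorm g v <= C * `|v : 'rV_n|.
Proof.
pose C := \sum_(i < n) tnorm g (delta_mx 0 i : tangent x).
have C0 : 0 <= C by apply: sumr_ge0 => i _; exact: tnorm_ge0.
exists (1 + C); first by rewrite ltr_pwDl.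
move=> v; apply: (@le_trans _ _ (C * `|v : 'rV_n|)); last first.
  by rewrite ler_wpM2r// lerDr.
rewrite mulr_suml [in leLHS](row_sum_delta v).
elim/big_rec2 : _ => [|i y w _ yw]; first by rewrite tnorm0.
apply: le_trans (ler_tnormD _ _ _) _; rewrite lerD// tnormZ mulrC.
by rewrite ler_wpM2l ?tnorm_ge0 ?norm_coord_le.
Qed.

(** The minimum of [tnorm] on the coordinate unit sphere is attained by compactness, and positive by
    definiteness. *)
Lemma tnorm_ge_norm :
  exists2 m, 0 < m & forall v : tangent x, m * `|v : 'rV_n| <= tnorm g v.
Proof.
have [C C0 tC] := tnorm_le_norm.
pose S := [set v : 'rV[R]_n | `|v| = 1].
(* The sphere is empty when [n = 0]; every [v] is then zero. *)
have [S0|/nonemptyPn S0] := pselect (S !=set0); last first.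
  exists 1 => // v; have [->|v0] := eqVneq v 0.
    by rewrite normr0 mulr0 tnorm_ge0.
  have : S (`|v : 'rV_n|^-1 *: v).
    by rewrite /S /= normrZ normfV normr_id mulVf// normr_eq0.
  by rewrite S0.
have cS : compact S.
  apply: bounded_closed_compact.
    by exists 1; split=> // y y1 v /= ->; exact: ltW.
  apply: (@closed_comp _ _ (fun v : 'rV[R]_n => `|v|) [set 1]).
    by move=> v _; exact: norm_continuous.
  exact: closed_eq.
have ct : {within S, continuous (fun v => tnorm g (v : tangent x))}.
  apply: continuous_subspaceT => v; apply: (@lipschitz_at_continuous _ _ _ _ C).
  near=> w; rewrite ler_norml lerNl opprB !lerBlDr; apply/andP; split.
    rewrite distrC; apply: le_trans (lerD (tC _) (lexx _)).
    by rewrite -{1}(subrK w v); exact: ler_tnormD.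
  apply: le_trans (lerD (tC _) (lexx _)).
  by rewrite -{1}(subrK v w); exact: ler_tnormD.
have [s sS smin] := EVT_min_rV S0 cS ct.
move: sS; rewrite inE /S /= => s1.
have s0 : s != 0 by rewrite -normr_eq0 s1 oner_neq0.
exists (tnorm g (s : tangent x)); first exact: tnorm_gt0.
move=> v; have [->|v0] := eqVneq v 0.
  by rewrite normr0 mulr0 tnorm_ge0.
have vn0 : 0 < `|v : 'rV_n| by rewrite normr_gt0.
have : tnorm g (s : tangent x) <= tnorm g (`|v : 'rV_n|^-1 *: v : tangent x).
  apply: smin; rewrite inE /S /= normrZ normfV normr_id mulVf//.
  by rewrite gt_eqF.
by rewrite tnormZ normfV normr_id mulrC ler_pdivlMr.
Unshelve. all: by end_near. Qed.

End NormComparison.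

Lemma diff_near_eq (R : realType) (V W : normedModType R) (f h : V -> W)
    (x : V) :
  differentiable f x -> differentiable h x -> (\forall y \near x, f y = h y) ->
  'd f x =1 'd h x.
Proof.
move=> df dh fh; apply: diff_unique_approx => // e e0.
have fhx : f x = h x := nbhs_singleton fh.
near=> y.
have -> : f y = h y by near: y.
rewrite fhx; near: y; exact: diff_approx.
Unshelve. all: by end_near. Qed.

Lemma diff_compE (R : realType) (U V W : normedModType R) (f : U -> V)
    (h : V -> W) (x v : U) (y : V) : f x = y ->
  differentiable f x -> differentiable h y ->
  'd h y ('d f x v) = 'd (h \o f) x v.
Proof. by move=> <- df dh; have /(congr1 (@^~ v)) -> := diff_comp df dh. Qed.

Section Charts.
Context {R : realType} {n : nat} {M : smoothManifold R n}.
Variable g : riemannianMetric M.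
Implicit Types (c : chart R n M) (q v : 'rV[R]_n).

Lemma near_cimg c q : cimg c q -> \forall q' \near q, cimg c q'.
Proof. by move=> cq; apply: open_nbhs_nbhs; split=> //; exact: open_cimg. Qed.

Lemma near_cdom c (x : M) : cdom c x -> \forall y \near x, cdom c y.
Proof. by move=> cq; apply: open_nbhs_nbhs; split=> //; exact: open_cdom. Qed.

Lemma near_cinv c q (P : M -> Prop) : cimg c q ->
  (\forall y \near cinv c q, P y) -> \forall q' \near q, P (cinv c q').
Proof. by move=> cq; exact: (cinv_continuous cq). Qed.

Lemma near_cmap c x (P : 'rV[R]_n -> Prop) : cdom c x ->
  (\forall q \near cmap c x, P q) -> \forall y \near x, P (cmap c y).
Proof. by move=> cx; exact: (cmap_continuous cx). Qed.

Lemma continuous_chart_at (T : topologicalType) (w : M -> T) (x : M) :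
  {for cmap (chart_at x) x, continuous (w \o cinv (chart_at x))} ->
  {for x, continuous w}.
Proof.
have dx := chart_at_dom x => cw.
have h : w \o cinv (chart_at x) \o cmap (chart_at x) @ x --> w x.
  rewrite -[in X in _ --> X](cmapK dx).
  exact: (continuous_comp (cmap_continuous dx) cw).
apply: cvg_trans h; apply: near_eq_cvg; near=> y.
by rewrite /= cmapK//; near: y; exact: near_cdom.
Unshelve. all: by end_near. Qed.

Lemma transition_differentiable c c' q : atlas c -> atlas c' ->
  cimg c q -> cdom c' (cinv c q) -> differentiable (cmap c' \o cinv c) q.
Proof.
move=> ac ac' cq c'q; apply: differentiable_rV => j.
by have [+ _] := atlas_smooth ac ac' 1 j; exact.
Qed.

(* Riemannian norm at [cinv c q] of the vector with components [v] in the chart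
   [c], meant for [y = cinv c q]; keeping [y] separate lets one rewrite
   [cinv c q] without changing the type [tangent y]. *)
Definition chart_tnorm (y : M) c q v : R :=
  tnorm g ('d (cmap (chart_at y) \o cinv c) q v : tangent y).

Lemma chart_tnorm_ge0 y c q v : 0 <= chart_tnorm y c q v.
Proof. exact: tnorm_ge0. Qed.

Lemma chart_tnormZ y c q a v :
  chart_tnorm y c q (a *: v) = `|a| * chart_tnorm y c q v.
Proof. by rewrite /chart_tnorm linearZ_LR tnormZ. Qed.

Lemma ler_chart_tnormD y c q v w :
  chart_tnorm y c q (v + w) <= chart_tnorm y c q v + chart_tnorm y c q w.
Proof. by rewrite /chart_tnorm linearD; exact: ler_tnormD. Qed.

(** The transition from a chart to itself is the identity near the point, so its differential is the
    identity. *)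
Lemma chart_tnorm_chart_at (x : M) v :
  chart_tnorm x (chart_at x) (cmap (chart_at x) x) v = tnorm g (v : tangent x).
Proof.
have cx := chart_at_dom x; have ax := chart_at_atlas x.
rewrite /chart_tnorm (diff_unique_approx (L := idfun))//.
  by apply: transition_differentiable => //; [exact: cmap_img | rewrite cmapK].
move=> e e0; near=> y.
rewrite /= (cinvK (cmap_img cx)) cinvK ?subrr ?normr0 ?mulr_ge0 ?(ltW e0)//.
by near: y; apply: near_cimg; exact: cmap_img.
Unshelve. all: by end_near. Qed.

(** Chain rule: passing from [c] to [chart_at y] through [c'] agrees near [q] with passing
    directly. *)
Lemma chart_tnorm_transition y c c' q v : atlas c -> atlas c' ->
  cimg c q -> cdom c' (cinv c q) -> cdom (chart_at y) (cinv c q) ->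
  chart_tnorm y c' (cmap c' (cinv c q)) ('d (cmap c' \o cinv c) q v) =
  chart_tnorm y c q v.
Proof.
move=> ac ac' cq c'q yq; have ay := chart_at_atlas y.
rewrite /chart_tnorm; congr (tnorm g _).
have d1 : differentiable (cmap c' \o cinv c) q.
  exact: transition_differentiable.
have d2 : differentiable (cmap (chart_at y) \o cinv c') (cmap c' (cinv c q)).
  apply: transition_differentiable => //; first exact: cmap_img.
  by rewrite cmapK.
have dE := diff_compE v (erefl (cmap c' (cinv c q))) d1 d2.
refine (eq_trans dE _); apply: diff_near_eq.
- exact: differentiable_comp.
- exact: transition_differentiable.
- near=> z; rewrite /= cmapK//; near: z.
  by apply: near_cinv => //; exact: near_cdom.
Unshelve. all: by end_near. Qed.

(** The chart [chart_at (cinv c q)] may jump with [q], whereas the Gram coefficients on the right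
    are those that [inner_smooth] makes regular. Continuity in [q] is drawn from this expansion. *)
Lemma sqr_chart_tnorm c q v : atlas c -> cimg c q ->
  chart_tnorm (cinv c q) c q v ^+ 2 =
  \sum_(i < n) \sum_(j < n)
    v 0 i * v 0 j * inner g (coord_vector c q i) (coord_vector c q j).
Proof.
move=> ac cq; rewrite sqr_tnorm {1 2}(row_sum_delta v) linear_sum /=.
have inner_suml (F : 'I_n -> 'rV[R]_n) (w : tangent (cinv c q)) :
    inner g (\sum_(i < n) F i : tangent (cinv c q)) w =
    \sum_(i < n) inner g (F i : tangent (cinv c q)) w.
  elim/big_rec2 : _ => [|i y z _ <-]; first exact: inner0l.
  exact: innerDl.
rewrite inner_suml; apply: eq_bigr => i _.
rewrite inner_sym inner_suml; apply: eq_bigr => j _.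
rewrite !linearZ_LR innerZl inner_sym innerZl.
by rewrite (inner_sym g (coord_vector c q i)) /coord_vector mulrCA mulrA.
Qed.

End Charts.

(** * The norm weighted by [f] and its continuity in the base point *)

Lemma continuous_dist_at (R : realType) (T : topologicalType) (h : T -> R)
    (x : T) :
  {for x, continuous h} -> {for x, continuous (fun y => `|h y - h x|)}.
Proof.
move=> ch; apply: (@cvg_norm _ R^o _ _ _ (fun y => h y - h x)).
by apply: (@cvgB _ R^o) => //; exact: cvg_cst.
Qed.

Lemma continuous_sum_at (R : realType) (T : topologicalType) (I : Type)
    (r : seq I) (F : I -> T -> R) (x : T) :
  (forall i, {for x, continuous (F i)}) ->
  {for x, continuous (fun y => \sum_(i <- r) F i y)}.
Proof.
move=> cF; elim: r => [|i r IH].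
  rewrite (_ : (fun _ => _) = cst 0); first exact: cst_continuous.
  by apply/funext => y; rewrite big_nil.
rewrite (_ : (fun _ => _) = F i \+ (fun y => \sum_(i <- r) F i y)).
  exact: continuousD.
by apply/funext => y; rewrite big_cons.
Qed.

Section Speed.
Context {R : realType} {n : nat} {M : smoothManifold R n}.
Variables (g : riemannianMetric M) (f : M -> R).
Hypothesis f_ge0 : forall x, 0 <= f x.
Hypothesis f_continuous : continuous f.
Implicit Types (c : chart R n M) (q v : 'rV[R]_n).

(** The norm of the conformal metric [f^2 g] read in the chart [c]; it degenerates where [f]
    vanishes. *)
Definition speed c q v : R := f (cinv c q) * chart_tnorm g (cinv c q) c q v.

Lemma speed_ge0 c q v : 0 <= speed c q v.
Proof. by rewrite mulr_ge0// chart_tnorm_ge0. Qed.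

Lemma speedZ c q a v : speed c q (a *: v) = `|a| * speed c q v.
Proof. by rewrite /speed chart_tnormZ mulrCA. Qed.

Lemma speedN c q v : speed c q (- v) = speed c q v.
Proof. by rewrite -scaleN1r speedZ normrN1 mul1r. Qed.

Lemma ler_speedD c q v w : speed c q (v + w) <= speed c q v + speed c q w.
Proof. by rewrite -mulrDr ler_wpM2l// ler_chart_tnormD. Qed.

Let gram c q i j := inner g (coord_vector c q i) (coord_vector c q j).

Let gram_norm c q v := \sum_(i < n) \sum_(j < n) v 0 i * v 0 j * gram c q i j.

Let chart_tnormE c q v : atlas c -> cimg c q ->
  chart_tnorm g (cinv c q) c q v = Num.sqrt (gram_norm c q v).
Proof.
move=> ac cq; rewrite /gram_norm /gram -(sqr_chart_tnorm g v ac cq) sqrtr_sqr.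
by rewrite ger0_norm// chart_tnorm_ge0.
Qed.

Let gram_norm_ge0 c q v : atlas c -> cimg c q -> 0 <= gram_norm c q v.
Proof.
by move=> ac cq; rewrite /gram_norm /gram -(sqr_chart_tnorm g v ac cq) sqr_ge0.
Qed.

Let sqrt_mul_norm (a : R) (v : 'rV[R]_n) :
  Num.sqrt a * `|v| = Num.sqrt (`|v| ^+ 2 * a).
Proof. by rewrite sqrtrM ?sqr_ge0// sqrtr_sqr normr_id mulrC. Qed.

Let gram_le (a : R) (v : 'rV[R]_n) (i j : 'I_n) :
  `|v 0 i * v 0 j * a| <= `|v| ^+ 2 * `|a|.
Proof.
by rewrite !normrM ler_wpM2r// expr2 ler_pM// norm_coord_le.
Qed.

Let gram_sum_le (F : 'I_n -> 'I_n -> R) (v : 'rV[R]_n) :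
  `|\sum_(i < n) \sum_(j < n) v 0 i * v 0 j * F i j| <=
  `|v| ^+ 2 * \sum_(i < n) \sum_(j < n) `|F i j|.
Proof.
apply: le_trans (ler_norm_sum _ _ _) _; rewrite mulr_sumr.
apply: ler_sum => i _; apply: le_trans (ler_norm_sum _ _ _) _.
by rewrite mulr_sumr; apply: ler_sum => j _; exact: gram_le.
Qed.

Lemma speed_le_norm c q : atlas c -> cimg c q ->
  exists2 C, 0 < C & forall v, speed c q v <= C * `|v|.
Proof.
move=> ac cq.
pose D := \sum_(i < n) \sum_(j < n) `|gram c q i j|.
exists (1 + f (cinv c q) * Num.sqrt D).
  by rewrite ltr_pwDl// mulr_ge0 ?sqrtr_ge0.
move=> v; rewrite mulrDl mul1r; apply: ler_wpDl => //.
rewrite /speed -mulrA ler_wpM2l//.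
rewrite chart_tnormE// sqrt_mul_norm.
by rewrite ler_wsqrtr// (le_trans (ler_norm _))// gram_sum_le.
Qed.

Lemma speed_continuous c q e : atlas c -> cimg c q -> 0 < e ->
  \forall q' \near q, forall v, `|speed c q' v - speed c q v| <= e * `|v|.
Proof.
move=> ac cq e0.
pose D q' := \sum_(i < n) \sum_(j < n) `|gram c q' i j - gram c q i j|.
pose C := Num.sqrt (\sum_(i < n) \sum_(j < n) `|gram c q i j|).
(* Modulus of continuity read off from [f' N' - f N = f' (N' - N) + (f' - f) N], where
   [|N' - N| <= sqrt D |v|] and [N <= C |v|]. It does not involve [v], is continuous, and vanishes
   at [q]. *)
pose k q' := f (cinv c q') * Num.sqrt (D q') +
  `|f (cinv c q') - f (cinv c q)| * C.
have cf : {for q, continuous (f \o cinv c)}.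
  by apply: continuous_comp; [exact: cinv_continuous | exact: f_continuous].
have kc : {for q, continuous k}.
  have cD : {for q, continuous D}.
    apply: continuous_sum_at => i; apply: continuous_sum_at => j.
    have cg : {for q, continuous (fun q' => gram c q' i j)}.
      by have := inner_smooth g ac i j 0; exact.
    exact: continuous_dist_at.
  have cs : {for q, continuous (fun q' => Num.sqrt (D q'))}.
    by apply: (continuous_comp cD); exact: sqrt_continuous.
  have cM := continuousM cf cs.
  have cC := continuousM (continuous_dist_at cf) (@cst_continuous _ _ C q).
  exact: (continuousD cM cC).
have k0 : k q = 0.
  rewrite /k subrr normr0 mul0r addr0 [D q]big1 ?sqrtr0 ?mulr0// => i _.
  by rewrite big1// => j _; rewrite subrr normr0.
have /cvgrPdist_le/(_ e e0) := kc; rewrite k0 => ke.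
near=> q' => v.
have cq' : cimg c q' by near: q'; exact: near_cimg.
apply: (@le_trans _ _ (k q' * `|v|)); last first.
  rewrite ler_wpM2r//; apply: le_trans (ler_norm _) _.
  by rewrite -normrN -sub0r; near: q'.
set N' := chart_tnorm g (cinv c q') c q' v.
set N := chart_tnorm g (cinv c q) c q v.
have N'0 : 0 <= N' by exact: chart_tnorm_ge0.
have N0 : 0 <= N by exact: chart_tnorm_ge0.
have NN : `|N' - N| <= Num.sqrt (D q') * `|v|.
  rewrite /N /N' !chart_tnormE// sqrt_mul_norm.
  apply: le_trans (ler_dist_sqrt _ _) _; rewrite ?gram_norm_ge0//.
  apply: ler_wsqrtr; apply: le_trans (gram_sum_le _ _).
  rewrite /gram_norm -sumrB le_eqVlt; apply/orP; left; apply/eqP.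
  congr (`| _ |); apply: eq_bigr => i _; rewrite -sumrB; apply: eq_bigr => j _.
  by rewrite mulrBr.
have NC : N <= C * `|v|.
  rewrite /N chart_tnormE// sqrt_mul_norm.
  by rewrite ler_wsqrtr// (le_trans (ler_norm _))// gram_sum_le.
rewrite /speed -/N -/N'.
have -> : f (cinv c q') * N' - f (cinv c q) * N =
    f (cinv c q') * (N' - N) + (f (cinv c q') - f (cinv c q)) * N by ring.
apply: le_trans (ler_normD _ _) _; rewrite /k [in leRHS]mulrDl -!mulrA !normrM.
rewrite (ger0_norm N0) (ger0_norm (f_ge0 _)).
by apply: lerD; rewrite ler_wpM2l.
Unshelve. all: by end_near. Qed.

End Speed.

(** * Functions of slope at most [f] *)

Section Subsolutions.
Context {R : realType} {n : nat} {M : smoothManifold R n}.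
Variables (g : riemannianMetric M) (f : M -> R).
Hypothesis f_ge0 : forall x, 0 <= f x.
Hypothesis f_continuous : continuous f.
Implicit Types (c : chart R n M) (q v : 'rV[R]_n) (w : M -> R).

(** The inequality [|dw| <= f] at one point, in a form that makes sense for [w] not
    differentiable. *)
Definition slope_at c q w := forall e, 0 < e -> \forall q' \near q,
  `|w (cinv c q') - w (cinv c q)| <= speed g f c q (q' - q) + e * `|q' - q|.

(* Subsolutions of [|dw| = f] in a pointwise, chart-independent sense. *)
Definition eikonal_sub w := forall c, atlas c -> forall q, cimg c q ->
  slope_at c q w.

(** The transition map is its differential up to a small error, and the differential carries the
    speed in one chart to the speed in the other. *)
Lemma slope_at_transition c c' q w : atlas c -> atlas c' ->
  cimg c q -> cdom c' (cinv c q) -> slope_at c q w ->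
  slope_at c' (cmap c' (cinv c q)) w.
Proof.
move=> ac ac' cq c'q wq e e0.
set s := cmap c' (cinv c q).
have sq : cinv c' s = cinv c q by exact: cmapK.
have c's : cimg c' s by exact: cmap_img.
have cs : cdom c (cinv c' s) by rewrite sq; exact: cinv_dom.
have ts : cmap c (cinv c' s) = q by rewrite sq cinvK.
have dt := transition_differentiable ac' ac c's cs.
have [K K0 BK] := linear_lipschitz (diff_continuous dt).
have [C C0 sC] := speed_le_norm g f_ge0 ac cq.
have speedE v : speed g f c' s v = speed g f c q ('d (cmap c \o cinv c') s v).
  rewrite /speed sq; congr (_ * _).
  have := chart_tnorm_transition g v ac' ac c's cs (y := cinv c q).
  by rewrite ts => ->//; rewrite sq; exact: chart_at_dom.
(* Each error gets [e / 2]: [e1], the remainder of the transition, is amplified by the speed bound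
   [C]; [e2], the slope error in [c], by the Lipschitz bound [K + 1] of the transition at [s]. *)
pose e1 := Num.min 1 (e / (2 * C)); pose e2 := e / (2 * (K + 1)).
have e10 : 0 < e1 by rewrite lt_min ltr01 divr_gt0// mulr_gt0.
have e20 : 0 < e2 by rewrite divr_gt0// mulr_gt0// addr_gt0.
have e11 : e1 <= 1 by rewrite ge_min lexx.
have e1C : C * e1 <= e / 2.
  rewrite mulrC -ler_pdivlMr// -mulrA -invfM ge_min; apply/orP; right.
  by rewrite lexx.
have e2K : e2 * (K + 1) = e / 2.
  rewrite /e2; field; rewrite gt_eqF// addr_gt0//.
have wq2 : \forall s' \near s,
    `|w (cinv c (cmap c (cinv c' s'))) - w (cinv c q)| <=
    speed g f c q (cmap c (cinv c' s') - q) + e2 * `|cmap c (cinv c' s') - q|.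
  have /(_ (fun q' => `|w (cinv c q') - w (cinv c q)| <=
    speed g f c q (q' - q) + e2 * `|q' - q|)) := differentiable_continuous dt.
  rewrite /= ts; apply; exact: wq.
have tapp := diff_approx dt e10; rewrite /= ts in tapp.
near=> s'.
have cs' : cdom c (cinv c' s').
  by near: s'; apply: near_cinv => //; exact: near_cdom.
have : `|w (cinv c (cmap c (cinv c' s'))) - w (cinv c q)| <=
    speed g f c q (cmap c (cinv c' s') - q) + e2 * `|cmap c (cinv c' s') - q|.
  by near: s'.
rewrite cmapK// sq => /le_trans; apply.
have happ : `|cmap c (cinv c' s') - q - 'd (cmap c \o cinv c') s (s' - s)|
    <= e1 * `|s' - s|.
  by near: s'.
set D := 'd (cmap c \o cinv c') s (s' - s) in happ *.
set T := cmap c (cinv c' s') - q in happ *.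
rewrite speedE -/D.
have T1 : speed g f c q T <= speed g f c q D + C * (e1 * `|s' - s|).
  rewrite -{1}(subrK D T) addrC.
  apply: le_trans (ler_speedD g f_ge0 _ _ _ _) _ => //.
  by rewrite lerD2l (le_trans (sC _))// ler_pM2l.
have T2 : `|T| <= (K + 1) * `|s' - s|.
  rewrite -(subrK D T) addrC mulrDl; apply: le_trans (ler_normD _ _) _.
  apply: lerD; first exact: BK.
  by apply: le_trans happ _; rewrite ler_wpM2r.
apply: le_trans (lerD T1 (ler_wpM2l (ltW e20) T2)) _.
rewrite -addrA lerD2l mulrA mulrA -mulrDl ler_wpM2r// e2K.
by rewrite [leRHS]splitr lerD2r.
Unshelve. all: by end_near. Qed.

(* The ball is uniform over all subsolutions: a mean value argument along
   segments in the chart bounds increments by the nearly constant speed. *)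
Lemma eikonal_sub_lipschitz c q e : atlas c -> cimg c q -> 0 < e ->
  exists2 d, 0 < d & forall w, eikonal_sub w -> forall a b,
    `|a - q| < d -> `|b - q| < d ->
    `|w (cinv c a) - w (cinv c b)| <= speed g f c q (a - b) + e * `|a - b|.
Proof.
move=> ac cq e0; have e2 : 0 < e / 2 by rewrite divr_gt0.
(* One half of [e] pays for the variation of the speed over the ball, the other for the slope error
   at each point of the segment. *)
have : \forall p \near q, cimg c p /\
    forall v, `|speed g f c p v - speed g f c q v| <= e / 2 * `|v|.
  near=> p; split; near: p; first exact: near_cimg.
  exact: speed_continuous.
move=> /nbhs_normP[d /= d0 hd]; exists d => // w wS a b.
suff {a b} H a b : `|a - q| < d -> `|b - q| < d ->
    w (cinv c a) - w (cinv c b) <= speed g f c q (a - b) + e * `|a - b|.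
  move=> ad bd; rewrite ler_norml lerNl opprB H// andbT.
  by rewrite -speedN opprB distrC H.
move=> ad bd.
pose p t := b + t *: (a - b).
have -> : a = p 1 by rewrite /p scale1r addrC subrK.
have -> : b = p 0 by rewrite /p scale0r addr0.
have -> : p 1 - p 0 = a - b.
  by rewrite /p scale1r scale0r addr0 addrAC subrr add0r.
apply: (@local_slope_bound _ (fun t => w (cinv c (p t)))) => t /andP[t0 t1].
have pt : `|q - p t| < d.
  rewrite distrC.
  have -> : p t - q = (1 - t) *: (b - q) + t *: (a - q).
    by apply/rowP => i; rewrite /p !mxE; ring.
  apply: le_lt_trans (ler_normD _ _) _; rewrite !normrZ.
  rewrite (ger0_norm t0) ger0_norm ?subr_ge0//.
  move: t0; rewrite le_eqVlt => /predU1P[<-|t0].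
    by rewrite subr0 mul0r mul1r addr0.
  have -> : d = (1 - t) * d + t * d by ring.
  by apply: ler_ltD; [rewrite ler_wpM2l ?subr_ge0// ltW | rewrite ltr_pM2l].
have [cp sp] := hd _ pt.
have pcont : {for t, continuous p}.
  apply: continuousD; first exact: cst_continuous.
  by apply: (@cvgZr_tmp R _ _ (nbhs t) _ (fun t : R => t)); exact: cvg_id.
have np := pcont _ (wS c ac (p t) cp _ e2); rewrite /= in np.
near=> s.
have /le_trans : `|w (cinv c (p s)) - w (cinv c (p t))| <=
    speed g f c (p t) (p s - p t) + e / 2 * `|p s - p t| by near: s.
apply; have -> : p s - p t = (s - t) *: (a - b).
  by rewrite /p opprD addrACA subrr add0r scalerBl.
rewrite speedZ normrZ (mulrCA (e / 2)) -mulrDr mulrC ler_wpM2r//.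
have := le_trans (ler_norm _) (sp (a - b)); rewrite lerBlDr => h.
by apply: le_trans (lerD h (lexx _)) _; rewrite addrAC -mulrDl -splitr addrC.
Unshelve. all: by end_near. Qed.

(* The one-sided form covers suprema as well as limits. *)
Lemma eikonal_sub_approx u :
  (forall x y e, 0 < e ->
    exists2 w, eikonal_sub w & u x - u y <= w x - w y + e) ->
  eikonal_sub u.
Proof.
move=> uw c ac q cq e e0.
have [d d0 hd] := eikonal_sub_lipschitz ac cq e0.
have H a b : `|a - q| < d -> `|b - q| < d ->
    u (cinv c a) - u (cinv c b) <= speed g f c q (a - b) + e * `|a - b|.
  move=> ad bd; apply/ler_addgt0Pl => k k0.
  have [w wS] := uw (cinv c a) (cinv c b) k k0 => /le_trans; apply.
  by rewrite addrC lerD2l (le_trans (ler_norm _))// hd.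
near=> p.
have pq : `|p - q| < d.
  near: p; exact: (near_dist_lt q d0).
have qq : `|q - q| < d by rewrite subrr normr0.
rewrite ler_norml lerNl opprB H// andbT.
by rewrite -speedN opprB distrC H.
Unshelve. all: by end_near. Qed.

Lemma eikonal_sub_cst k : eikonal_sub (cst k).
Proof.
move=> c ac q cq e e0; near=> p.
by rewrite subrr normr0 addr_ge0// ?speed_ge0// mulr_ge0// ltW.
Unshelve. all: by end_near. Qed.

Lemma eikonal_subDr w k : eikonal_sub w -> eikonal_sub (fun x => w x + k).
Proof.
move=> wS; apply: eikonal_sub_approx => x y e e0; exists w => //.
rewrite opprD addrACA subrr addr0; lra.
Qed.

Lemma eikonal_sub_locally_bounded x : exists C,
  \forall y \near x, forall w, eikonal_sub w -> `|w y - w x| <= C.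
Proof.
have ax := chart_at_atlas x; have dx := chart_at_dom x.
have cx := cmap_img dx.
have [d d0 hd] := eikonal_sub_lipschitz ax cx ltr01.
have [C C0 sC] := speed_le_norm g f_ge0 ax cx.
have nd := near_cmap dx (near_dist_lt (cmap (chart_at x) x) d0).
exists (C * d + 1 * d); near=> y => w wS.
have yx : `|cmap (chart_at x) y - cmap (chart_at x) x| < d.
  by near: y.
have := hd w wS _ (cmap (chart_at x) x) yx.
rewrite subrr normr0 => /(_ d0).
rewrite !cmapK//; last by near: y; exact: near_cdom.
move=> /le_trans; apply; apply: lerD.
  by apply: le_trans (sC _) _; rewrite ler_wpM2l ?ltW.
by rewrite ler_wpM2l ?ltW.
Unshelve. all: by end_near. Qed.

Lemma eikonal_sub_continuous w : eikonal_sub w -> continuous w.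
Proof.
move=> wS x.
have ax := chart_at_atlas x; have dx := chart_at_dom x.
have cx := cmap_img dx.
have [C C0 sC] := speed_le_norm g f_ge0 ax cx.
apply: continuous_chart_at; apply: (@lipschitz_at_continuous _ _ _ _ (C + 1)).
near=> q; rewrite mulrDl.
apply: (@le_trans _ _ (speed g f (chart_at x) (cmap (chart_at x) x)
    (q - cmap (chart_at x) x) + 1 * `|q - cmap (chart_at x) x|)).
  by near: q; exact: wS.
by rewrite lerD2r.
Unshelve. all: by end_near. Qed.

(** The points [x] admitting such a [C] form an open and closed set, because the local bound is
    common to all subsolutions and can be used in both directions. *)
Lemma eikonal_sub_bounded (Mconn : connected [set: M]) (x0 x : M) :
  exists C, forall w, eikonal_sub w -> `|w x - w x0| <= C.
Proof.
pose B := [set x | exists C, forall w, eikonal_sub w -> `|w x - w x0| <= C].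
suff BT : B = setT by have : B x by rewrite BT.
have step y z C : (forall w, eikonal_sub w -> `|w z - w y| <= C) -> B y -> B z.
  move=> h [D hD]; exists (C + D) => w wS.
  by apply: le_trans (ler_distD (w y) _ _) _; rewrite lerD ?h ?hD.
have nB y : \forall z \near y, B y <-> B z.
  have [C hC] := eikonal_sub_locally_bounded y; near=> z.
  have hz : forall w, eikonal_sub w -> `|w z - w y| <= C by near: z.
  split; first exact: step hz.
  by apply: (step _ _ C) => w wS; rewrite distrC hz.
have oB : open B.
  by rewrite openE => y By; apply: filterS (nB y) => z [+ _]; exact.
have cB : closed B.
  rewrite -openC openE => y By.
  by apply: filterS (nB y) => z [_ zy] /zy.
apply: Mconn; first by exists x0; exists 0 => w _; rewrite subrr normr0.
  by exists B => //; rewrite setTI.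
by exists B => //; rewrite setTI.
Unshelve. all: by end_near. Qed.

End Subsolutions.

(** * The eikonal distance *)

Section DualNorm.
Context {R : realType} {n : nat} {M : smoothManifold R n}.
Variables (g : riemannianMetric M) (x : M) (p : cotangent x).

(** The value of [sup] on an unbounded set is the default 0, so finiteness has to come first; it
    follows from comparing [tnorm] with the coordinate norm. *)
Let dual_norm_has_ubound :
  has_ubound [set `|p v| | v in [set v : tangent x | tnorm g v <= 1]].
Proof.
have [m m0 mN] := tnorm_ge_norm g x.
exists ((\sum_(i < n) `|p (delta_mx 0 i)|) / m) => _ [w /= w1 <-].
apply: (@le_trans _ _ ((\sum_(i < n) `|p (delta_mx 0 i)|) * `|w : 'rV_n|)).
  rewrite [in leLHS](row_sum_delta w) linear_sum.
  apply: le_trans (ler_norm_sum _ _ _) _; rewrite mulr_suml.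
  apply: ler_sum => i _; rewrite linearZ_LR normrM mulrC.
  by rewrite ler_wpM2l// norm_coord_le.
rewrite ler_wpM2l ?sumr_ge0//.
by rewrite -[leRHS]mul1r ler_pdivlMr// mulrC (le_trans (mN w)).
Qed.

Lemma dual_norm_ge0 : 0 <= dual_norm g p.
Proof.
apply: ub_le_sup => //.
by exists 0; [rewrite /= tnorm0 | rewrite linear0 normr0].
Qed.

Lemma ler_dual_norm (v : tangent x) : `|p v| <= dual_norm g p * tnorm g v.
Proof.
have [->|v0] := eqVneq (v : 'rV_n) 0.
  by rewrite linear0 normr0 tnorm0 mulr0.
have N0 := tnorm_gt0 g v0.
rewrite -ler_pdivrMr//; apply: ub_le_sup => //.
exists ((tnorm g v)^-1 *: v : 'rV_n).
  by rewrite /= tnormZ normfV gtr0_norm// mulVf// gt_eqF.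
by rewrite linearZ_LR normrM normfV (gtr0_norm N0) mulrC.
Qed.

Lemma dual_norm_le a : 0 <= a ->
  (forall v : tangent x, `|p v| <= a * tnorm g v) -> dual_norm g p <= a.
Proof.
move=> a0 pa; apply: ge_sup => [|_ [v /= v1 <-]].
  by exists 0; exists 0; [rewrite /= tnorm0 | rewrite linear0 normr0].
by apply: le_trans (pa v) _; rewrite -[leRHS]mulr1 ler_wpM2l.
Qed.

End DualNorm.

Lemma ler_dist_max (R : realType) (a b a' b' e : R) :
  `|a - a'| <= e -> `|b - b'| <= e ->
  `|Num.max a b - Num.max a' b'| <= e.
Proof.
rewrite !ler_norml => /andP[h1 h2] /andP[h3 h4].
by case: (leP a b); case: (leP a' b') => *; apply/andP; split; lra.
Qed.

Section Distance.
Context {R : realType} {n : nat} {M : smoothManifold R n}.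
Variables (g : riemannianMetric M) (f : M -> R).
Hypothesis f_ge0 : forall x, 0 <= f x.
Hypothesis f_continuous : continuous f.
Hypothesis Mconn : connected [set: M].
Implicit Types (c : chart R n M) (q v : 'rV[R]_n) (w : M -> R).

(** Dual form of the distance of the degenerate metric [f^2 g]: the largest subsolution vanishing at
    [y], without recourse to curves. *)
Definition eikonal_dist y x : R :=
  sup [set w x | w in [set w | eikonal_sub g f w /\ w y = 0]].

Let dist_set_has_sup y x :
  has_sup [set w x | w in [set w | eikonal_sub g f w /\ w y = 0]].
Proof.
split; first by exists 0, (cst 0) => //; split=> //; exact: eikonal_sub_cst.
have [C hC] := eikonal_sub_bounded g f_ge0 f_continuous Mconn y x.
exists C => _ [w [wS wy] <-]; apply: le_trans (ler_norm _) _.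
by have := hC _ wS; rewrite wy subr0.
Qed.

(** A competitor nearly optimal at [x] stays below the supremum at [z], so its increment from [z] to
    [x] nearly dominates that of the supremum. *)
Lemma eikonal_sub_dist y : eikonal_sub g f (eikonal_dist y).
Proof.
apply: eikonal_sub_approx => // x z e e0.
have [_ [w [wS wy] <-] we] := sup_adherent e0 (dist_set_has_sup y x).
exists w => //; have : w z <= eikonal_dist y z.
  by apply: ub_le_sup (dist_set_has_sup y z).2 _ _; exists w.
move: we; rewrite -/(eikonal_dist y x); lra.
Qed.

Lemma eikonal_sub_le_dist w y x : eikonal_sub g f w ->
  w x - w y <= eikonal_dist y x.
Proof.
move=> wS; apply: ub_le_sup (dist_set_has_sup y x).2 _ _.
exists (fun x => w x - w y) => //; split; last by rewrite subrr.
exact: eikonal_subDr.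
Qed.

Lemma eikonal_distxx y : eikonal_dist y y = 0.
Proof.
apply/le_anti/andP; split.
  by apply: ge_sup (dist_set_has_sup y y).1 _ => _ [w [_ wy] <-]; rewrite wy.
by have := eikonal_sub_le_dist y y (eikonal_sub_cst g f_ge0 0); rewrite subrr.
Qed.

Lemma compact_chart_ball c q r : (forall p, `|p - q| <= r -> cimg c p) ->
  compact (cinv c @` [set p | `|p - q| <= r]).
Proof.
move=> rc; apply: continuous_compact.
  apply: continuous_in_subspaceT => p; rewrite inE => /rc.
  exact: cinv_continuous.
exact: (@compact_norm_preimage _ _ q [set t | t <= r] r).
Qed.

(** The closed coordinate ball has a compact image, which is closed since [M] is Hausdorff: no point
    outside the chart is a limit of it. *)
Lemma near_not_chart_ball c q r x : (forall p, `|p - q| <= r -> cimg c p) ->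
  ~ cdom c x -> \forall y \near x, ~ (cdom c y /\ `|cmap c y - q| <= r).
Proof.
move=> rc cx.
have := compact_closed (hausdorff_carrier (s := M)) (compact_chart_ball rc).
rewrite -openC => oK.
have : nbhs x (~` (cinv c @` [set p | `|p - q| <= r])).
  apply: open_nbhs_nbhs; split=> // -[p /= /rc cp xp].
  by apply: cx; rewrite -xp; exact: cinv_dom.
apply: filterS => y Ky [cy yq]; apply: Ky.
by exists (cmap c y) => //; rewrite cmapK.
Qed.

(** Inside the ball, a maximum of two functions inherits their common slope bound. On the sphere
    [psi < u], so the maximum is [u] nearby and the two definitions match. *)
Lemma eikonal_sub_glue c q r u (psi : 'rV[R]_n -> R) : atlas c ->
  (forall p, `|p - q| <= r -> cimg c p) ->
  eikonal_sub g f u ->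
  continuous psi ->
  (forall p, `|p - q| < r ->
    forall p', `|psi p' - psi p| <= speed g f c p (p' - p)) ->
  (forall p, `|p - q| = r -> psi p < u (cinv c p)) ->
  eikonal_sub g f (fun x => if `[< cdom c x /\ `|cmap c x - q| < r >]
    then Num.max (u x) (psi (cmap c x)) else u x).
Proof.
move=> ac rc uS psic psiS psiu.
set w := (w in eikonal_sub g f w).
move=> c' ac' q' cq'; set x := cinv c' q'.
have [[cx xr]|nx] := pselect (cdom c x /\ `|cmap c x - q| < r).
  have cp := cmap_img cx.
  (* The slope is checked in [c], where [psi] lives, and transported to [c']. *)
  have -> : q' = cmap c' (cinv c (cmap c x)) by rewrite cmapK// cinvK.
  apply: slope_at_transition => //; first by rewrite cmapK//; exact: cinv_dom.
  have nr : \forall p \near cmap c x, `|p - q| < r.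
    have : 0 < r - `|cmap c x - q| by rewrite subr_gt0.
    move=> /(near_dist_lt (cmap c x)); apply: filterS => p pr.
    by apply: le_lt_trans (ler_distD (cmap c x) _ _) _; rewrite -ltrBrDr.
  move=> e e0; have uS' := uS c ac _ cp e e0.
  near=> p.
  have cp' : cimg c p by near: p; exact: near_cimg.
  have wE p' : cimg c p' -> `|p' - q| < r ->
      w (cinv c p') = Num.max (u (cinv c p')) (psi p').
    move=> cp'' pr; rewrite /w asboolT ?cinvK//.
    by split=> //; exact: cinv_dom.
  rewrite !wE//; last by near: p.
  apply: ler_dist_max; first by near: p.
  apply: le_trans (psiS _ xr p) _.
  by rewrite lerDl mulr_ge0 ?(ltW e0).
suff wu : \forall y \near x, w y = u y.
  have wux := nbhs_singleton wu.
  have wun := near_cinv cq' wu.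
  move=> e e0; have uS' := uS c' ac' q' cq' e e0; near=> p.
  rewrite -/x wux (_ : w (cinv c' p) = u (cinv c' p)); last by near: p.
  by near: p.
(* Three cases remain: [x] outside the chart, on the sphere, or in the chart beyond the closed
   ball. *)
have [cx|ncx] := pselect (cdom c x); last first.
  apply: filterS (near_not_chart_ball rc ncx) => y ny.
  by rewrite /w asboolF// => -[cy /ltW yr]; exact: ny (conj cy yr).
have rx : r <= `|cmap c x - q|.
  by rewrite leNgt; apply/negP => xr; exact: nx (conj cx xr).
move: rx; rewrite le_eqVlt => /predU1P[rx|rx].
  have := psiu (cmap c x) (esym rx); rewrite cmapK// => h.
  have uc := eikonal_sub_continuous f_ge0 uS (x := x).
  have pc : {for x, continuous (psi \o cmap c)}.
    by apply: continuous_comp; [exact: cmap_continuous | exact: psic].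
  have h2 : 0 < (u x - psi (cmap c x)) / 2 by rewrite divr_gt0// subr_gt0.
  have /cvgrPdist_lt/(_ _ h2) n1 := uc.
  have /cvgrPdist_lt/(_ _ h2) n2 := pc.
  near=> y; rewrite /w; case: ifP => // _; apply/max_idPl.
  have : `|u x - u y| < (u x - psi (cmap c x)) / 2 by near: y.
  have : `|(psi \o cmap c) x - (psi \o cmap c) y| < (u x - psi (cmap c x)) / 2.
    by near: y.
  rewrite /= !ltr_norml => /andP[? ?] /andP[? ?]; lra.
have : 0 < `|cmap c x - q| - r by rewrite subr_gt0.
move=> /(near_dist_lt (cmap c x))/(near_cmap cx); apply: filterS => y yx.
rewrite /w asboolF// => -[_ yr].
have := ler_distD (cmap c y) (cmap c x) q; rewrite leNgt => /negP; apply.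
rewrite distrC; lra.
Unshelve. all: by end_near. Qed.

End Distance.

(** * Viscosity properties of limits of distances *)

Section Limit.
Context {R : realType} {n : nat} {M : smoothManifold R n}.
Variables (g : riemannianMetric M) (f : M -> R).
Hypothesis f_ge0 : forall x, 0 <= f x.
Hypothesis f_continuous : continuous f.
Implicit Types (u phi : M -> R).

Lemma Ck_fun1_differentiable phi (x : M) : Ck_fun 1 phi ->
  differentiable (phi \o cinv (chart_at x) : 'rV[R]_n -> R^o)
    (cmap (chart_at x) x).
Proof.
move=> phi1; have [+ _] := phi1 _ (chart_at_atlas x); apply.
exact/cmap_img/chart_at_dom.
Qed.

Lemma speed_chart_at (x : M) v :
  speed g f (chart_at x) (cmap (chart_at x) x) v =
  f x * tnorm g (v : tangent x).
Proof.
by rewrite /speed cmapK ?chart_tnorm_chart_at//; exact: chart_at_dom.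
Qed.

(** At the maximum, [phi] decreases no faster than [u] to first order, so [- p w - speed w] is at
    most [o(|w|)], hence nonpositive by homogeneity. Applying this to [v] and [- v] bounds
    [|p v|]. *)
Lemma eikonal_sub_differential u phi (x : M) : eikonal_sub g f u ->
  Ck_fun 1 phi -> (forall y, u y - phi y <= u x - phi x) ->
  dual_norm g (differential phi x) <= f x.
Proof.
move=> uS phi1 umax; apply: dual_norm_le => // v.
have dx := chart_at_dom x; have ax := chart_at_atlas x.
have dphi := Ck_fun1_differentiable x phi1.
set p := differential phi x; set q := cmap (chart_at x) x in dphi.
suff H w : - p w - speed g f (chart_at x) q w <= 0.
  rewrite -speed_chart_at ler_norml lerNl.
  have := H v; have := H (- v); rewrite linearN opprK speedN !subr_le0.
  by move=> -> ->.
apply: (@pos_homogeneous_le0 _ _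
  (fun w => - p w - speed g f (chart_at x) q w) q) => [t {}w t0|e e0].
  by rewrite speedZ linearZ_LR gtr0_norm// /GRing.scale /= mulrBr mulrN.
have e2 : 0 < e / 2 by rewrite divr_gt0.
have hu := uS _ ax q (cmap_img dx) _ e2.
have hphi := diff_approx dphi e2.
near=> q'.
have : `|u (cinv (chart_at x) q') - u (cinv (chart_at x) q)| <=
  speed g f (chart_at x) q (q' - q) + e / 2 * `|q' - q| by near: q'.
have : `|phi (cinv (chart_at x) q') - phi (cinv (chart_at x) q) - p (q' - q)|
  <= e / 2 * `|q' - q| by near: q'.
rewrite cmapK// !ler_norml => /andP[h1 h2] /andP[h3 h4].
have h5 := umax (cinv (chart_at x) q').
rewrite -/p lerBlDr [e in leRHS]splitr mulrDl.
move: h1 h2 h3 h4 h5.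
move: (speed _ _ _ _ _) (e / 2 * _) (p _) (u _) (u _) (phi _) (phi _).
by move=> *; lra.
Unshelve. all: by end_near. Qed.

Hypothesis Mconn : connected [set: M].

Section Escape.
Variables (G : set_system M) (k u : M -> R).
Context {GF : ProperFilter G}.
Hypothesis dist_cvg : forall x,
  (fun y => eikonal_dist g f y x - k y) @ G --> u x.

Lemma near_dist_limit x e : 0 < e ->
  \forall y \near G, `|u x - (eikonal_dist g f y x - k y)| < e.
Proof. by move: e; apply/cvgrPdist_lt; exact: dist_cvg. Qed.

(** An increment of [u] is within [e] of that of one distance function, since the normalization
    [k y] cancels. *)
Lemma eikonal_sub_limit : eikonal_sub g f u.
Proof.
apply: eikonal_sub_approx => // x z e e0.
have e2 : 0 < e / 2 by rewrite divr_gt0.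
have : \forall y \near G, u x - u z <=
    eikonal_dist g f y x - eikonal_dist g f y z + e.
  near=> y.
  have : `|u x - (eikonal_dist g f y x - k y)| < e / 2.
    by near: y; exact: near_dist_limit.
  have : `|u z - (eikonal_dist g f y z - k y)| < e / 2.
    by near: y; exact: near_dist_limit.
  by rewrite !ltr_norml => /andP[? ?] /andP[? ?]; lra.
move=> /filter_ex[y hy]; exists (eikonal_dist g f y) => //.
exact: eikonal_sub_dist.
Unshelve. all: by end_near. Qed.

(* Compactness of the coordinate sphere turns pointwise convergence of the
   equi-Lipschitz distance functions into a uniform strict inequality. *)
Lemma near_above_on_sphere c q r (psi : 'rV[R]_n -> R) : atlas c ->
  (forall p, `|p - q| <= r -> cimg c p) -> continuous psi ->
  (forall p, `|p - q| = r -> psi p < u (cinv c p)) ->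
  \forall y \near G, forall p, `|p - q| = r ->
    psi p < eikonal_dist g f y (cinv c p) - k y.
Proof.
move=> ac rc psic psiu.
have : compact [set p | `|p - q| = r].
  by apply: (@compact_norm_preimage _ _ q [set t | t = r] r) => // t ->.
rewrite compact_near_coveringP => /(_ _ G
  (fun y p => psi p < eikonal_dist g f y (cinv c p) - k y) _).
move=> /(_ _); apply => p /= pr.
have cp : cimg c p by apply: rc; rewrite pr.
have [d d0 hd] := eikonal_sub_lipschitz g f_ge0 f_continuous ac cp ltr01.
have [C C0 sC] := speed_le_norm g f_ge0 ac cp.
(* The gap is shared by the variation of [psi], the error of the limit at [p], and the variation of
   the distance from [p] to [p'], which is bounded uniformly in [y]. *)
pose eta := (u (cinv c p) - psi p) / 3.
have eta0 : 0 < eta by rewrite divr_gt0// subr_gt0 psiu.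
have C1 : 0 < C + 1 by rewrite addr_gt0.
have d2 : 0 < Num.min d (eta / (C + 1)) by rewrite lt_min d0 divr_gt0.
have /cvgrPdist_lt/(_ _ eta0) npsi := psic p.
have ndist := near_dist_limit (cinv c p) eta0.
have nd := near_dist_lt p d2.
exists ([set p' | `|psi p - psi p'| < eta] `&`
        [set p' | `|p' - p| < Num.min d (eta / (C + 1))],
        [set y | `|u (cinv c p) -
                   (eikonal_dist g f y (cinv c p) - k y)| < eta]).
  by split=> //=; apply: filterI.
move=> [p' y] /= [[h1 h2] h3].
move: h2; rewrite lt_min ltr_pdivlMr// => /andP[h2 h4].
have := hd _ (eikonal_sub_dist g f_ge0 f_continuous Mconn y) p' p h2.
rewrite subrr normr0 => /(_ d0) h5.
have h6 := le_trans h5 (lerD (sC _) (lexx _)).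
rewrite -mulrDl mulrC in h6.
move: h1 h3 h4 h6; rewrite !ltr_norml ler_norml => /andP[h1 h1'].
move=> /andP[h3 h3'] h4 /andP[h6 h6'].
have h7 : u (cinv c p) - psi p = 3 * eta by rewrite /eta; field.
lra.
Unshelve. all: by end_near. Qed.

(** If the inequality failed, a cone with apex [delta] above [u x] could be glued onto the
    normalized distance from some [y] outside [U]. The result would exceed the distance at [x] with
    the same value at [y], against maximality. *)
Lemma limit_differential phi (x : M) :
  (0 < f x -> exists2 U, nbhs x U & G (~` U)) ->
  Ck_fun 1 phi -> (forall y, u x - phi x <= u y - phi y) ->
  f x <= dual_norm g (differential phi x).
Proof.
move=> escape phi1 umin; rewrite leNgt; apply/negP => pf.
have [U xU GU] := escape (le_lt_trans (dual_norm_ge0 _ _) pf).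
have dx := chart_at_dom x; have ax := chart_at_atlas x.
set c := chart_at x in dx ax.
have dphi := Ck_fun1_differentiable x phi1.
set p := differential phi x in pf; set q := cmap c x in dphi.
have cq : cimg c q by exact: cmap_img.
have xq : cinv c q = x by exact: cmapK.
have [m m0 mN] := tnorm_ge_norm g x.
(* Half of the slack, in coordinate norm: one [a] is the opening of the cone [psi], the other
   absorbs the variation of the speed near [q]. *)
pose a := (f x - dual_norm g p) * m / 2.
have a0 : 0 < a by rewrite divr_gt0// mulr_gt0// subr_gt0.
have a2 : 0 < a / 2 by rewrite divr_gt0.
have nspeed := speed_continuous g f_ge0 f_continuous ax cq a0.
have nphi := diff_approx dphi a2.
have nU : \forall p \near q, U (cinv c p) by apply: near_cinv => //; rewrite xq.
have : \forall p' \near q, [/\ cimg c p', U (cinv c p'),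
    `|phi (cinv c p') - phi (cinv c q) - p (p' - q)| <= a / 2 * `|p' - q| &
    forall v, `|speed g f c p' v - speed g f c q v| <= a * `|v|].
  by near=> p'; split; near: p' => //; exact: near_cimg.
move=> /nbhs_normP[d /= d0 hd].
pose r := d / 2; have r0 : 0 < r by rewrite divr_gt0.
have rd : r < d by rewrite /r; lra.
have {}hd p' : `|p' - q| <= r -> [/\ cimg c p', U (cinv c p'),
    `|phi (cinv c p') - phi (cinv c q) - p (p' - q)| <= a / 2 * `|p' - q| &
    forall v, `|speed g f c p' v - speed g f c q v| <= a * `|v|].
  by move=> p'r; apply: hd; rewrite /= distrC (le_lt_trans p'r).
have rc p' : `|p' - q| <= r -> cimg c p' by move=> /hd[].
(* On the sphere the cone drops by [a * r], while [phi] departs from its linear part by at most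
   [a * r / 2]; raising the apex by [a * r / 4] keeps [psi] below [u] there. *)
pose delta := a * r / 4.
have delta0 : 0 < delta by rewrite divr_gt0// mulr_gt0.
pose psi p' := u x + delta + p (p' - q) - a * `|p' - q|.
have psiB p1 p2 : psi p2 - psi p1 =
    p (p2 - p1) - a * (`|p2 - q| - `|p1 - q|).
  have -> : p (p2 - p1) = p (p2 - q) - p (p1 - q).
    by rewrite -linearB opprB addrA subrK.
  rewrite /psi; ring.
have psi_lip p1 p2 : `|psi p2 - psi p1| <=
    dual_norm g p * tnorm g (p2 - p1 : tangent x) + a * `|p2 - p1|.
  rewrite psiB; apply: le_trans (ler_normB _ _) _.
  apply: lerD; first exact: ler_dual_norm.
  rewrite normrM gtr0_norm// ler_pM2l// (le_trans (ler_dist_dist _ _))//.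
  by rewrite opprB addrA subrK.
have psic : continuous psi.
  move=> p1; have [C C0 tC] := tnorm_le_norm g x.
  apply: (@lipschitz_at_continuous _ _ _ _ (f x * C + a)); near=> p2.
  apply: le_trans (psi_lip p1 p2) _; rewrite mulrDl lerD2r -mulrA.
  apply: le_trans (ler_wpM2r (tnorm_ge0 _ _) (ltW pf)) _.
  by rewrite ler_wpM2l.
have psiS p1 : `|p1 - q| < r -> forall p2,
    `|psi p2 - psi p1| <= speed g f c p1 (p2 - p1).
  move=> /ltW/hd[_ _ _ sp] p2; apply: le_trans (psi_lip _ _) _.
  have := sp (p2 - p1); rewrite ler_norml => /andP[+ _].
  rewrite speed_chart_at.
  have : (f x - dual_norm g p) * (m * `|p2 - p1|) <=
      (f x - dual_norm g p) * tnorm g (p2 - p1 : tangent x).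
    by rewrite ler_wpM2l ?subr_ge0 ?(ltW pf)//; exact: mN.
  have : (f x - dual_norm g p) * (m * `|p2 - p1|) = 2 * (a * `|p2 - p1|).
    by rewrite /a; field.
  rewrite !mulrBl.
  move: (_ * (m * _)) (_ * (m * _)) (f x * _) (speed _ _ _ _ _).
  move: (a * _) (dual_norm _ _ * _) => *; lra.
have psiu p1 : `|p1 - q| = r -> psi p1 < u (cinv c p1).
  move=> p1r; have [|_ _ + _] := hd p1; first by rewrite p1r.
  rewrite xq p1r ler_norml => /andP[h1 _].
  have h2 := umin (cinv c p1).
  rewrite /psi p1r; move: h1 h2; rewrite /delta.
  have : 0 < a * r by rewrite mulr_gt0.
  have -> : a / 2 * r = a * r / 2 by rewrite mulrAC.
  move: (a * r) (p _) (u _) (u _) (phi _) (phi _) => *; lra.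
have nsphere := near_above_on_sphere ax rc psic psiu.
have nx := near_dist_limit x delta0.
have : \forall y \near G, [/\ ~ U y,
  forall p, `|p - q| = r -> psi p < eikonal_dist g f y (cinv c p) - k y &
  `|u x - (eikonal_dist g f y x - k y)| < delta].
  by near=> y; split; near: y.
move=> /filter_ex[y [yU ysphere yx]].
have vS : eikonal_sub g f (fun z => eikonal_dist g f y z - k y).
  by apply: eikonal_subDr => //; exact: eikonal_sub_dist.
have wS := eikonal_sub_glue f_ge0 ax rc vS psic psiS ysphere.
have := eikonal_sub_le_dist f_ge0 f_continuous Mconn y x wS.
rewrite asboolT; last by rewrite subrr normr0.
(* The glued ball lies in [U] and [y] does not, so the value at [y] is still [- k y]. *)
rewrite asboolF; last first.
  move=> [cy /ltW/hd[_ + _ _]]; rewrite cmapK//.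
rewrite eikonal_distxx// sub0r opprK -lerBrDr => h.
have {h} := le_trans (_ : psi q <= _) h.
rewrite le_max lexx orbT => /(_ isT).
rewrite {1}/psi -/q subrr linear0 normr0 mulr0 subr0 addr0.
move: yx; rewrite ltr_norml => /andP[]; lra.
Unshelve. all: by end_near. Qed.

End Escape.
End Limit.

(** * Ultrafilter limits and existence of a solution *)

(** The image of an ultrafilter is an ultrafilter, here on a compact segment. A single [G] thus
    gives limits at all points of [M] at once. *)
Lemma ultra_bounded_cvg (R : realType) (T : Type) (G : set_system T)
    (h : T -> R) (C : R) :
  UltraFilter G -> (forall y, `|h y| <= C) -> exists l : R, h @ G --> l.
Proof.
move=> GU hC.
have FU : UltraFilter (h @ G).
  split=> [|H HP GH]; first exact: fmap_proper_filter.
  apply/seteqP; split=> // A HA.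
  have [//|GnA] := in_ultra_setVsetC (h @^-1` A) GU.
  have : H (~` A) by exact: GH.
  by move=> /(filterI HA); rewrite setICr => /filter_not_empty.
have := @segment_compact R (- C) C; rewrite compact_ultra => /(_ _ FU).
case; last by move=> l [_ hl]; exists l.
by apply: (@filterE _ G) => y; rewrite /= in_itv/= -ler_norml hC.
Qed.

(** The neighbourhoods of infinity. *)
Definition cocompact (T : topologicalType) : set_system T :=
  [set A | exists2 K, compact K & ~` K `<=` A].

Lemma cocompact_proper (T : topologicalType) : ~ compact [set: T] ->
  ProperFilter (@cocompact T).
Proof.
move=> ncT; split.
  move=> [K cK] /subsetC; rewrite setC0 setCK => TK; apply: ncT.
  by rewrite (_ : setT = K)//; apply/seteqP; split.
split; first by exists set0; [exact: compact0|].
- move=> A B [K cK KA] [L cL LB]; exists (K `|` L); first exact: compactU.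
  by rewrite setCU; exact: setISS.
- by move=> A B AB [K cK KA]; exists K => //; exact: subset_trans AB.
Qed.

Section Existence.
Context {R : realType} {n : nat} {M : smoothManifold R n}.
Variables (g : riemannianMetric M) (f : M -> R).
Hypothesis f_ge0 : forall x, 0 <= f x.
Hypothesis f_continuous : continuous f.
Hypothesis Mconn : connected [set: M].

Lemma compact_nbhs (x : M) : exists2 K, nbhs x K & compact K.
Proof.
have dx := chart_at_dom x; have cx := cmap_img dx.
have /nbhs_normP[d /= d0 hd] := near_cimg cx.
have d2 : 0 < d / 2 by rewrite divr_gt0.
have dd : d / 2 < d by lra.
exists (cinv (chart_at x) @` [set p | `|p - cmap (chart_at x) x| <= d / 2]).
  have := near_cmap dx (near_dist_lt (cmap (chart_at x) x) d2) => nd.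
  near=> y; exists (cmap (chart_at x) y); last first.
    by rewrite cmapK//; near: y; exact: near_cdom.
  by apply: ltW; near: y.
apply: compact_chart_ball => p pd; apply: hd.
by rewrite /= distrC (le_lt_trans pd).
Unshelve. all: by end_near. Qed.

(* When [f] vanishes at [x0] the limit is the distance to [x0]; otherwise [M]
   is not compact and the source escapes to infinity, as for Busemann
   functions. *)
Lemma escaping_filter : (compact [set: M] -> exists x0, f x0 = 0) ->
  exists G : set_system M, UltraFilter G /\
    forall x, 0 < f x -> exists2 U, nbhs x U & G (~` U).
Proof.
move=> cMf; have [/cMf[x0 fx0]|ncM] := pselect (compact [set: M]).
  (* The source stays at [x0]; a point where [f] is positive differs from [x0], so it can be
     separated from it. *)
  exists (principal_filter x0); split; first exact: principal_filter_ultra.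
  move=> y fy; exists (~` [set x0]); last first.
    by rewrite setCK; exact/principal_filterP.
  apply: open_nbhs_nbhs; split.
    by apply: closed_openC; apply: accessible_closed_set1;
      apply: hausdorff_accessible; exact: hausdorff_carrier.
  by move=> yx0; move: fy; rewrite yx0 fx0 ltxx.
have [G [GU FG]] := ultraFilterLemma (cocompact_proper ncM).
exists G; split=> // y _; have [K yK cK] := compact_nbhs y.
by exists K => //; apply: FG; exists K.
Qed.

Lemma exists_eikonal_solution (x1 : M) :
  (compact [set: M] -> exists x0, f x0 = 0) ->
  exists2 u, eikonal_sub g f u & forall phi, Ck_fun 1 phi -> forall x,
    (forall y, u x - phi x <= u y - phi y) ->
    f x <= dual_norm g (differential phi x).
Proof.
move=> /escaping_filter[G [GU escape]].
(* Normalizing at [x1] turns the values into increments of subsolutions, bounded independently of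
   [y]. *)
pose k y := eikonal_dist g f y x1.
have hu x : exists l : R, (fun y => eikonal_dist g f y x - k y) @ G --> l.
  have [C hC] := eikonal_sub_bounded g f_ge0 f_continuous Mconn x1 x.
  apply: (@ultra_bounded_cvg _ _ _ _ C) => y; apply: hC.
  exact: eikonal_sub_dist.
have [u uP] := choice hu.
exists u; first exact: eikonal_sub_limit uP.
move=> phi phi1 x.
exact: (limit_differential f_ge0 f_continuous Mconn uP (escape x) phi1).
Qed.

End Existence.

Theorem corollary1p2 (R : realType) (n : nat) (M : smoothManifold R n)
    (g : riemannianMetric M) (V : M -> R)
    (Mconn : connected [set: M])
    (gcomplete : complete_metric g)
    (Vbounded : exists K : R, forall x : M, `|V x| <= K)
    (VC2 : Ck_fun 2 V) :
  exists u : M -> R, viscosity_solution (hamiltonian g V) (sup (range V)) u.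
Proof.
have [K VK] := Vbounded.
set c := sup (range V).
have Vc x : V x <= c.
  apply: ub_le_sup; last by exists x.
  by exists K => _ [y _ <-]; exact: le_trans (ler_norm _) (VK y).
have Vcont : continuous V.
  move=> x; have [dV _] := VC2 _ (chart_at_atlas x).
  apply: continuous_chart_at; apply: differentiable_continuous.
  exact/dV/cmap_img/chart_at_dom.
pose f x := Num.sqrt (2 * (c - V x)).
have f_ge0 x : 0 <= f x by exact: sqrtr_ge0.
have f_sqr x : f x ^+ 2 = 2 * (c - V x).
  by rewrite sqr_sqrtr// mulr_ge0// subr_ge0.
have f_continuous : continuous f.
  move=> x; apply: (@continuous_comp _ _ _ (fun x => 2 * (c - V x)) Num.sqrt).
    apply: continuousM; first exact: cst_continuous.
    by apply: (@continuousB _ R^o); [exact: cst_continuous | exact: Vcont].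
  exact: sqrt_continuous.
(* Connectedness as stated allows an empty [M], for which the viscosity conditions are vacuous. *)
have [[x1 _]|M0] := pselect (exists x1 : M, True); last first.
  exists (cst 0); split; split; try exact: cst_continuous.
    by move=> phi _ x; case: M0; exists x.
  by move=> phi _ x; case: M0; exists x.
have [cM|u uS usup] := exists_eikonal_solution g f_ge0 f_continuous Mconn x1.
  (* On a compact [M], [V] attains its supremum, and [f] vanishes there. *)
  have [||x0 _ Vmax] := compact_EVT_max _ cM (f := V); first by exists x1.
    exact: continuous_subspaceT.
  exists x0; rewrite /f (_ : c - V x0 = 0) ?mulr0 ?sqrtr0//.
  apply/eqP; rewrite subr_eq0 eq_le Vc andbT; apply: ge_sup.
    by exists (V x1), x1.
  by move=> _ [y _ <-]; apply: Vmax; rewrite inE.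
have uc := eikonal_sub_continuous f_ge0 uS.
exists u; split; split=> // phi phi1 x ux; rewrite /hamiltonian.
  (* Both sides being nonnegative, comparing norms amounts to comparing squares, and
     [f^2 = 2 (c - V)] restores the Hamiltonian. *)
  have : dual_norm g (differential phi x) ^+ 2 <= f x ^+ 2.
    rewrite ler_pXn2r ?nnegrE ?dual_norm_ge0//.
    exact: eikonal_sub_differential ux.
  rewrite f_sqr; lra.
have : f x ^+ 2 <= dual_norm g (differential phi x) ^+ 2.
  by rewrite ler_pXn2r ?nnegrE ?dual_norm_ge0// usup.
rewrite f_sqr; lra.
Qed.
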